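(* Let $F$ be a real Banach space with a $1$-unconditional normalised Schauder basis, and let $X_1,X_2,\dots$ be Banach spaces with the Daugavet property. Then their $F$-sum $X=(X_1,X_2,\dots)_F$ has the Daugavet property if and only if the Banach lattice $F$ has the positive Daugavet property, i.e. $\|\mathrm{Id}+T\|=1+\|T\|$ for every positive rank-$1$ operator $T: F\to F$.
   Context: All Banach spaces are real and the spaces $X_j$ are nonzero. A Banach space $X$ has the Daugavet property if $\|\mathrm{Id}+T\|=1+\|T\|$ for every bounded rank-$1$ linear operator $T: X\to X$. Elements of $F$ are identified with their coordinate sequences $(a_j)$ with respect to the basis (a finite or infinite sequence, according to the dimension of $F$), so that $\|(a_1,a_2,\dots)\|_F=\|(|a_1|,|a_2|,\dots)\|_F$ for all $(a_j)\in F$ and the unit vectors have norm $1$; $F$ is a Banach lattice under the pointwise (coordinatewise) order. The number of spaces $X_j$ equals the number of basis vectors of $F$. The $F$-sum $(X_1,X_2,\dots)_F$ consists of all sequences $(x_j)$ with $x_j\in X_j$ and $(\|x_j\|)\in F$, with norm $\|(x_j)\|=\|(\|x_j\|)\|_F$. *)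

(* Defs.v *)
From HB Require Import structures.
From mathcomp Require Import all_boot all_order all_algebra.
From mathcomp Require Import ring.
From mathcomp Require Import all_classical all_reals all_analysis.

Set Implicit Arguments.
Unset Strict Implicit.
Unset Printing Implicit Defensive.

Import Order.TTheory GRing.Theory Num.Theory.
Import numFieldNormedType.Exports.

Local Open Scope classical_set_scope.
Local Open Scope ring_scope.

Section operators.
Variables (R : realType) (V W : normedModType R).

Definition opnorm (T : V -> W) : R :=
  sup [set `|T x| | x in [set x : V | `|x| <= 1]].

(* For a linear [T]: the range of [T] has dimension exactly 1. *)
Definition rank_one (T : V -> W) : Prop :=
  exists2 y : W, y != 0 & range T = range (fun c : R => c *: y).

End operators.

(* For linear maps, [bounded_near T (nbhs 0)] is boundedness of the operator
   (see [linear_boundedP]). *)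
Definition daugavet (R : realType) (X : completeNormedModType R) : Prop :=
  forall T : {linear X -> X},
    bounded_near T (nbhs (0 : X)) -> rank_one T ->
    opnorm (fun x => x + T x) = 1 + opnorm T.

(* Index set of a basis: {0, ..., n-1} for [Some n], all of nat for [None]. *)
Definition in_range (N : option nat) (i : nat) : bool :=
  if N is Some n then (i < n)%N else true.

Definition basis_index (N : option nat) : Type := {i : nat | in_range N i}.

Section bases.
Variables (R : realType) (F : completeNormedModType R) (N : option nat).
Implicit Types (e : basis_index N -> F) (a b c : basis_index N -> R).

(* The [i]-th term of the series expansion; it is 0 past the last basis
   vector, so that finite bases are covered by the same formulas. *)
Definition basis_term e a (i : nat) : F :=
  if insub i is Some j then a j *: e j else 0.

Definition is_expansion e a (x : F) : Prop :=
  series (basis_term e a) @ \oo --> x.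

Definition schauder_basis e : Prop :=
  forall x : F, exists! a, is_expansion e a x.

(* The sequence of absolute values of the coordinates of [x] again represents
   an element of [F], with the same norm. *)
Definition unconditional1 e : Prop :=
  forall a x, is_expansion e a x ->
    exists2 y, is_expansion e (fun j => `|a j|) y & `|y| = `|x|.

Record unconditional_basis := UnconditionalBasis {
  basis_vect :> basis_index N -> F ;
  basis_schauder : schauder_basis basis_vect ;
  basis_normalised : forall j, `|basis_vect j| = 1 ;
  basis_unconditional1 : unconditional1 basis_vect }.

Variable e : unconditional_basis.

Lemma coord_ex (x : F) : exists a, is_expansion e a x.
Proof. by have [a [? _]] := basis_schauder e x; exists a. Qed.

Definition bcoord (x : F) : basis_index N -> R := projT1 (cid (coord_ex x)).

Definition positive_operator (T : F -> F) : Prop :=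
  forall x, (forall j, 0 <= bcoord x j) -> forall j, 0 <= bcoord (T x) j.

Definition positive_daugavet : Prop :=
  forall T : {linear F -> F},
    bounded_near T (nbhs (0 : F)) -> rank_one T -> positive_operator T ->
    opnorm (fun x => x + T x) = 1 + opnorm T.

Lemma coordP x : is_expansion e (bcoord x) x.
Proof. by rewrite /bcoord; case: cid. Qed.
Arguments coordP : clear implicits.

Lemma expansion_uniq a b x : is_expansion e a x -> is_expansion e b x -> a = b.
Proof.
move=> ax bx; have [c [_ cu]] := basis_schauder e x.
by rewrite -(cu a ax) -(cu b bx).
Qed.

Lemma coord_expansion a x : is_expansion e a x -> bcoord x = a.
Proof. exact/expansion_uniq/coordP. Qed.

Lemma expansion_inj a x y : is_expansion e a x -> is_expansion e a y -> x = y.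
Proof. by move=> ax ay; exact: (norm_cvg_unique ax ay). Qed.

Lemma coord_inj x y : bcoord x = bcoord y -> x = y.
Proof.
by move=> xy; have := coordP x; rewrite xy => h; apply: expansion_inj h (coordP y).
Qed.

Lemma expansionD a b x y : is_expansion e a x -> is_expansion e b y ->
  is_expansion e (fun j => a j + b j) (x + y).
Proof.
move=> ax bx; rewrite /is_expansion.
have -> : series (basis_term e (fun j => a j + b j)) =
    series (basis_term e a) \+ series (basis_term e b).
  apply/funext => n; rewrite /series/= -big_split/=; apply: eq_bigr => i _.
  by rewrite /basis_term; case: insub => [j|]; rewrite ?scalerDl ?addr0.
exact: cvgD.
Qed.

Lemma expansionZ k a x : is_expansion e a x ->
  is_expansion e (fun j => k * a j) (k *: x).
Proof.
move=> ax; rewrite /is_expansion.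
have -> : series (basis_term e (fun j => k * a j)) =
    (fun n => k *: series (basis_term e a) n).
  apply/funext => n; rewrite /series/= scaler_sumr; apply: eq_bigr => i _.
  by rewrite /basis_term; case: insub => [j|]; rewrite ?scalerA ?scaler0.
exact: cvgZl_tmp.
Qed.
Arguments expansionZ k {a x} _.

Lemma expansion0 : is_expansion e (fun=> 0) 0.
Proof.
have := expansionZ 0 (coordP 0); rewrite scale0r.
by congr (is_expansion e _ 0); apply/funext => j; rewrite mul0r.
Qed.

Lemma basis_term_val a (j : basis_index N) : basis_term e a (val j) = a j *: e j.
Proof. by rewrite /basis_term valK. Qed.

Lemma expansion_single j k :
  is_expansion e (fun i => if i == j then k else 0) (k *: e j).
Proof.
rewrite /is_expansion; apply: cvg_near_cst; exists (val j).+1 => // n /= jn.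
rewrite /series/= (big_cat_nat _ (n := (val j).+1))//= big_nat_recr//=.
rewrite basis_term_val eqxx big_nat big1 ?add0r ?big_nat ?big1 ?addr0//.
- move=> i /andP[ji _]; rewrite /basis_term; case: insubP => // l _ li.
  by case: eqP => [lj|]; [rewrite -li lj ltnn in ji | rewrite scale0r].
- move=> i /andP[_ ij]; rewrite /basis_term; case: insubP => // l _ li.
  by case: eqP => [lj|]; [rewrite -li lj ltnn in ij | rewrite scale0r].
Qed.

Arguments expansion_single j k : clear implicits.

Lemma expansion_sum a m n : exists2 d,
  is_expansion e d (\sum_(m <= i < n) basis_term e a i) &
  forall k, ~~ (m <= val k < n)%N -> d k = 0.
Proof.
elim: n => [|n [d dx d0]].
  by rewrite big_geq//; exists (fun=> 0) => //; exact: expansion0.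
have [mn|mn] := leqP m n; last first.
  by rewrite big_geq//; exists (fun=> 0) => //; exact: expansion0.
rewrite big_nat_recr//= {2}/basis_term; case: insubP => [j _ jn|_].
  eexists; first exact: (expansionD dx (expansion_single j (a j))).
  move=> k /=; case: eqP => [->|kj kmn]; first by rewrite jn mn ltnSn.
  rewrite d0 ?addr0//; apply: contra kmn => /andP[-> /=].
  by move=> /ltnW; rewrite ltnS.
exists d; first by rewrite addr0.
move=> k kmn; rewrite d0//; apply: contra kmn => /andP[-> /=].
by move=> /ltnW; rewrite ltnS.
Qed.

Lemma norm_expansion a b x y : is_expansion e a x -> is_expansion e b y ->
  (forall j, `|a j| = `|b j|) -> `|x| = `|y|.
Proof.
move=> ax bx ab; have [x' ax' <-] := basis_unconditional1 ax.
have [y' bx' <-] := basis_unconditional1 bx.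
rewrite (_ : (fun j => _) = fun j => `|b j|) in ax'; last exact/funext.
by rewrite (expansion_inj ax' bx').
Qed.

Lemma norm_change1 c v j (k l : R) : is_expansion e c v -> c j = 0 ->
  `|k| <= `|l| -> `|v + k *: e j| <= `|v + l *: e j|.
Proof.
move=> cv cj kl.
have nl : `|v + - l *: e j| = `|v + l *: e j|.
  apply: (norm_expansion (expansionD cv (expansion_single j (- l)))
    (expansionD cv (expansion_single j l))).
  by move=> i /=; case: eqP => [->|_//]; rewrite cj !add0r normrN.
have [l0|l0] := eqVneq l 0.
  by move: kl; rewrite l0 normr0 normr_le0 => /eqP ->.
pose t := k / l.
have kE : k = t * l by rewrite /t divfK.
have /andP[t1 t2] : -1 <= t <= 1.
  by rewrite -ler_norml /t normf_div ler_pdivrMr ?mul1r ?normr_gt0.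
have E p q : p *: (v + l *: e j) + q *: (v + - l *: e j) =
    (p + q) *: v + ((p - q) * l) *: e j.
  by rewrite mulrBl scalerBl scalerDl !scalerDr !scalerA mulrN scaleNr addrACA.
have -> : v + k *: e j = ((1 + t) / 2) *: (v + l *: e j)
                       + ((1 - t) / 2) *: (v + - l *: e j).
  rewrite E kE; have -> : (1 + t) / 2 + (1 - t) / 2 = 1 by field.
  by have -> : (1 + t) / 2 - (1 - t) / 2 = t; [field|rewrite scale1r].
rewrite (le_trans (ler_normD _ _))// !normrZ nl -mulrDl.
rewrite !ger0_norm ?divr_ge0 ?subr_ge0// -?mulrDl; last by rewrite -lerBlDl sub0r.
by rewrite addrACA subrr addr0 divff// mul1r.
Qed.

Lemma norm_change a b c u m n : is_expansion e c u ->
  (forall j, (m <= val j < m + n)%N -> c j = 0) ->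
  (forall j, `|b j| <= `|a j|) ->
  `|u + \sum_(m <= i < m + n) basis_term e b i| <=
  `|u + \sum_(m <= i < m + n) basis_term e a i|.
Proof.
move=> + + ba; elim: n m u c => [|n IHn] m u c cu c0.
  by rewrite addn0 !big_geq.
have E d : \sum_(m <= i < m + n.+1) basis_term e d i =
    basis_term e d m + \sum_(m.+1 <= i < m.+1 + n) basis_term e d i.
  by rewrite big_ltn ?addnS ?ltnS ?leq_addr// addSn.
rewrite !E.
have [mj|[j _ jm]] : basis_term e a m = 0 /\ basis_term e b m = 0 \/
    exists2 j : basis_index N, true & val j = m.
- by rewrite /basis_term; case: insubP => [j _ jm|_]; [right; exists j|left].
- rewrite mj.1 mj.2 !add0r; apply: (IHn _ _ _ cu) => j /andP[mj' jn].
  by apply: c0; rewrite (ltnW mj') addnS -addSn.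
- have cj : c j = 0 by apply: c0; rewrite jm leqnn/= addnS ltnS leq_addr.
  rewrite -jm !basis_term_val !addrA jm.
  have [d dx d0] := expansion_sum a m.+1 (m.+1 + n).
  have vx := expansionD cu dx.
  rewrite (le_trans (IHn m.+1 _ _ (expansionD cu (expansion_single j (b j))) _))//.
    move=> i /andP[mi im] /=; rewrite c0 ?add0r; last first.
      by rewrite (ltnW mi) addnS -addSn.
    by case: eqP => // ij; move: mi; rewrite ij jm ltnn.
  rewrite (addrAC u (a j *: e j)) (addrAC u (b j *: e j)); apply: (norm_change1 vx) => //=.
  by rewrite cj d0 ?addr0// jm ltnn.
Qed.

Lemma norm_partial a b m n : (forall j, `|b j| <= `|a j|) ->
  `|\sum_(m <= i < n) basis_term e b i| <= `|\sum_(m <= i < n) basis_term e a i|.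
Proof.
move=> ba; have [nm|/ltnW mn] := leqP n m; first by rewrite !big_geq.
by have := @norm_change a b _ 0 m (n - m) expansion0; rewrite subnKC// !add0r; apply.
Qed.

Lemma solid a b x : is_expansion e a x -> (forall j, `|b j| <= `|a j|) ->
  exists2 y, is_expansion e b y & `|y| <= `|x|.
Proof.
move=> ax ba.
have : cvg (series (basis_term e b) @ \oo).
  apply/cauchy_cvgP/cauchy_seriesP => r r0.
  have /cvg_cauchy/cauchy_seriesP/(_ r r0) : cvg (series (basis_term e a) @ \oo).
    by apply/cvg_ex; exists x.
  by apply: filterS => p; apply: le_lt_trans; exact: norm_partial.
move=> bl; exists (lim (series (basis_term e b) @ \oo)); first exact: bl.
apply: (ler_cvg_to (cvg_norm bl) (cvg_norm ax)).
by apply: nearW => n; exact: norm_partial.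
Qed.

Lemma norm_solid x y : (forall j, `|bcoord y j| <= `|bcoord x j|) -> `|y| <= `|x|.
Proof.
move=> /(solid (coordP x))[z yz]; suff -> : y = z by [].
exact: expansion_inj (coordP y) yz.
Qed.

Lemma coordD x y j : bcoord (x + y) j = bcoord x j + bcoord y j.
Proof. by rewrite (coord_expansion (expansionD (coordP x) (coordP y))). Qed.

Lemma coordZ k x j : bcoord (k *: x) j = k * bcoord x j.
Proof. by rewrite (coord_expansion (expansionZ k (coordP x))). Qed.

Lemma coord0 j : bcoord 0 j = 0.
Proof. by rewrite (coord_expansion expansion0). Qed.

Lemma coordB x y j : bcoord (x - y) j = bcoord x j - bcoord y j.
Proof. by rewrite -scaleN1r coordD coordZ mulN1r. Qed.

Lemma coord_le_norm x j : `|bcoord x j| <= `|x|.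
Proof.
have : `|bcoord x j *: e j| <= `|x|.
  apply: norm_solid => i; rewrite (coord_expansion (expansion_single j _)).
  by case: eqP => [->//|_]; rewrite normr0.
by rewrite normrZ basis_normalised mulr1.
Qed.

End bases.
Arguments coordP {R F N} e x.

Section Fsum.
Variables (R : realType) (F : completeNormedModType R) (N : option nat).
Variables (e : unconditional_basis F N) (X : basis_index N -> completeNormedModType R).

Record Fsum := MkFsum {
  Fsum_val :> forall j, X j ;
  Fsum_valP : exists f : F, bcoord e f = fun j => `|Fsum_val j| }.

HB.instance Definition _ := gen_eqMixin Fsum.
HB.instance Definition _ := gen_choiceMixin Fsum.

Implicit Types x y z : Fsum.

Lemma Fsum_ext x y : (forall j, x j = y j) -> x = y.
Proof.
case: x y => [x px] [y py] /= xy; have {}xy : x = y by exact: functional_extensionality_dep.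
by case: _ / xy py => py; rewrite (Prop_irrelevance px py).
Qed.

(* The element [(`|x j|)_j] of [F]. *)
Definition Fsum_abs x : F := projT1 (cid (Fsum_valP x)).

Lemma coord_Fsum_abs x j : bcoord e (Fsum_abs x) j = `|x j|.
Proof. by rewrite /Fsum_abs; case: cid => f /= ->. Qed.

Lemma Fsum_dominated (x : forall j, X j) (f : F) :
  (forall j, `|x j| <= bcoord e f j) ->
  exists f : F, bcoord e f = fun j => `|x j|.
Proof.
move=> xf; have [|y /coord_expansion yx _] :=
  solid (b := fun j => `|x j|) (coordP e f); last by exists y.
by move=> j; rewrite normr_id (le_trans (xf j))// ler_norm.
Qed.

Definition Fsum_zero : Fsum.
Proof.
by exists (fun=> 0); apply: (@Fsum_dominated _ 0) => j; rewrite normr0 coord0.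
Defined.

Definition Fsum_opp x : Fsum.
Proof.
exists (fun j => - x j); apply: (@Fsum_dominated _ (Fsum_abs x)) => j.
by rewrite normrN coord_Fsum_abs.
Defined.

Definition Fsum_add x y : Fsum.
Proof.
exists (fun j => x j + y j).
apply: (@Fsum_dominated _ (Fsum_abs x + Fsum_abs y)) => j.
by rewrite coordD !coord_Fsum_abs ler_normD.
Defined.

Definition Fsum_scale (k : R) x : Fsum.
Proof.
exists (fun j => k *: x j); apply: (@Fsum_dominated _ (`|k| *: Fsum_abs x)) => j.
by rewrite coordZ coord_Fsum_abs normrZ.
Defined.

Fact Fsum_addA : associative Fsum_add.
Proof. by move=> x y z; apply: Fsum_ext => j /=; rewrite addrA. Qed.
Fact Fsum_addC : commutative Fsum_add.
Proof. by move=> x y; apply: Fsum_ext => j /=; rewrite addrC. Qed.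
Fact Fsum_add0 : left_id Fsum_zero Fsum_add.
Proof. by move=> x; apply: Fsum_ext => j /=; rewrite add0r. Qed.
Fact Fsum_addN : left_inverse Fsum_zero Fsum_opp Fsum_add.
Proof. by move=> x; apply: Fsum_ext => j /=; rewrite addNr. Qed.

HB.instance Definition _ := GRing.isZmodule.Build Fsum
  Fsum_addA Fsum_addC Fsum_add0 Fsum_addN.

Fact Fsum_scaleA k l x : Fsum_scale k (Fsum_scale l x) = Fsum_scale (k * l) x.
Proof. by apply: Fsum_ext => j /=; rewrite scalerA. Qed.
Fact Fsum_scale1 : left_id 1 Fsum_scale.
Proof. by move=> x; apply: Fsum_ext => j /=; rewrite scale1r. Qed.
Fact Fsum_scaleDr : right_distributive Fsum_scale +%R.
Proof. by move=> k x y; apply: Fsum_ext => j /=; rewrite scalerDr. Qed.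
Fact Fsum_scaleDl x : {morph Fsum_scale^~ x : k l / k + l}.
Proof. by move=> k l; apply: Fsum_ext => j /=; rewrite scalerDl. Qed.

HB.instance Definition _ := GRing.Zmodule_isLmodule.Build R Fsum
  Fsum_scaleA Fsum_scale1 Fsum_scaleDr Fsum_scaleDl.

Definition Fsum_norm x : R := `|Fsum_abs x|.

Fact Fsum_normD x y : Fsum_norm (x + y) <= Fsum_norm x + Fsum_norm y.
Proof.
rewrite (le_trans _ (ler_normD _ _))//; apply: (norm_solid (e := e)) => j.
rewrite coordD !coord_Fsum_abs normr_id ger0_norm ?addr_ge0//.
exact: ler_normD.
Qed.

Fact Fsum_normZ k x : Fsum_norm (k *: x) = `|k| * Fsum_norm x.
Proof.
rewrite -[`|k|]normr_id -normrZ; congr `|_|; apply: (coord_inj (e := e)).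
by apply/funext => j; rewrite coordZ !coord_Fsum_abs normrZ.
Qed.

Fact Fsum_norm_eq0 x : Fsum_norm x = 0 -> x = 0.
Proof.
move=> /normr0_eq0 x0; apply: Fsum_ext => j; apply/normr0_eq0.
by rewrite -coord_Fsum_abs x0 coord0.
Qed.

HB.instance Definition _ := Lmodule_isNormed.Build R Fsum
  Fsum_normD Fsum_normZ Fsum_norm_eq0.

Lemma Fsum_normE x : `|x| = `|Fsum_abs x|. Proof. by []. Qed.

Lemma FsumB x y j : (x - y) j = x j - y j. Proof. by []. Qed.

Lemma Fsum_proj_le x j : `|x j| <= `|x|.
Proof.
by rewrite -(coord_Fsum_abs x) (le_trans (ler_norm _))// coord_le_norm.
Qed.

Lemma Fsum_abs_le x y : `|Fsum_abs x - Fsum_abs y| <= `|x - y|.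
Proof.
apply: (norm_solid (e := e)) => j; rewrite coordB !coord_Fsum_abs normr_id.
exact: ler_dist_dist.
Qed.

Lemma cauchy_lipschitz (V : completeNormedModType R) (h : Fsum -> V)
    (G : set_system Fsum) : ProperFilter G -> cauchy G ->
  (forall x y, `|h x - h y| <= `|x - y|) -> exists l : V, h @ G --> l.
Proof.
move=> PG cG hl; apply/cvg_ex; apply: cauchy_cvg; apply: cauchy_exP => r r0.
have /cauchyP/(_ r r0)[x Gx] := cG.
exists (h x); apply: (@filterS _ G _ (ball x r) (h @^-1` ball (h x) r)) Gx => y.
by rewrite -!ball_normE /=; apply: le_lt_trans; exact: hl.
Qed.

Fact Fsum_complete (G : set_system Fsum) : ProperFilter G -> cauchy G -> cvg G.
Proof.
move=> PG cG.
have xlP j : exists l : X j, (fun x => x j) @ G --> l.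
  by apply: cauchy_lipschitz => // x y; rewrite -FsumB; exact: Fsum_proj_le.
pose xl j := projT1 (cid (xlP j)).
have Gxl j : (fun x => x j) @ G --> xl j by rewrite /xl; case: cid.
have gP y : exists2 g, (fun z => Fsum_abs (y - z)) @ G --> g &
    bcoord e g = fun j => `|y j - xl j|.
  have [|g Gg] := @cauchy_lipschitz _ (fun z => Fsum_abs (y - z)) G PG cG.
    move=> z z'; rewrite (le_trans (Fsum_abs_le _ _))//.
    by rewrite opprB addrC addrA subrK distrC.
  exists g => //; apply/funext => j.
  have c1 : (fun z => bcoord e (Fsum_abs (y - z)) j) @ G --> bcoord e g j.
    apply/cvgrPdist_lt => r r0; move/cvgrPdist_lt : Gg => /(_ r r0).
    apply: filterS => z; apply: le_lt_trans.
    by rewrite -coordB; exact: coord_le_norm.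
  have c2 : (fun z => bcoord e (Fsum_abs (y - z)) j) @ G --> `|y j - xl j|.
    rewrite (_ : (fun z => _) = fun z => `|y j - z j|); last first.
      by apply/funext => z; rewrite coord_Fsum_abs.
    by apply: cvg_norm; apply: cvgB; [exact: cvg_cst|exact: Gxl].
  exact: (norm_cvg_unique c1 c2).
have xl_mem : exists f : F, bcoord e f = fun j => `|xl j|.
  have [g _ g0] := gP 0; exists g; rewrite g0; apply/funext => j.
  by rewrite sub0r normrN.
pose x := MkFsum xl_mem.
apply/cvg_ex; exists x; apply/cvgrPdist_le => r r0.
have r2 : 0 < r / 2 by rewrite divr_gt0.
have /cauchyP/(_ _ r2)[y Gy] := cG.
have [g Gg gE] := gP y.
have yx : `|y - x| <= r / 2.
  have -> : `|y - x| = `|g|.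
    rewrite Fsum_normE; congr `|_|; apply: (coord_inj (e := e)); rewrite gE; apply/funext => j.
    by rewrite coord_Fsum_abs.
  apply: (ler_cvg_to (cvg_norm Gg) (cvg_cst (r / 2))).
  by apply: filterS Gy => z; rewrite -ball_normE => /ltW.
apply: filterS Gy => z; rewrite -ball_normE /= => /ltW yz.
by rewrite (splitr r) (le_trans (ler_distD y _ _))// lerD// distrC.
Qed.

HB.instance Definition _ := Uniform_isComplete.Build Fsum Fsum_complete.

End Fsum.

(* Main.v *)
Require Import Defs.
From HB Require Import structures.
From mathcomp Require Import all_boot all_order all_algebra.
From mathcomp Require Import lra.
From mathcomp Require Import all_classical all_reals all_analysis.

Set Implicit Arguments.
Unset Strict Implicit.
Unset Printing Implicit Defensive.

Import Order.TTheory GRing.Theory Num.Theory.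
Import numFieldNormedType.Exports.

Local Open Scope classical_set_scope.
Local Open Scope ring_scope.

(** A rank-one operator can be written [phi (x) y : x |-> phi x *: y] with
    [|y| = 1], and for such an operator the Daugavet equation says that
    [|x + phi x *: y|] comes arbitrarily close to [1 + |phi|] on the unit ball.
    The [F]-sum and [F] are compared by translating pairs [(phi, y)] between
    them.

    From the sum to [F] ([positive_daugavet_of_Fsum]).  Choose unit vectors
    [v j] in [X j] and functionals [n j] of norm one with [n j (v j) = 1].
    A positive pair [(phi, y)] on [F] becomes the pair formed by
    [psi x = phi ((n j (x j))_j)] and [x0 = (y_j v_j)_j].  It has at least the
    same norm, and passing from [x] to the sequence of norms [(|x j|)_j] can
    only increase [|x + psi x *: x0|], because [phi] and [y] are positive and the
    norm of [F] is monotone in the moduli of the coordinates.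

    From [F] to the sum ([Fsum_daugavet]).  Given [(psi, x0)] on the sum, let
    [c j] be the norm of the restriction of [psi] to the [j]-th summand.  The
    positive functional [g f = sum_(j < n) c j * f_j] dominates, for [n] large,
    the value of [psi] at a prescribed point [z], so the positive Daugavet
    property applied to [g] and [(|x0 j|)_j] yields [f >= 0] in the unit ball
    with [|f + g f *: (|x0 j|)_j|] almost [1 + |psi z|].  The Daugavet property
    of each [X j] lifts the coordinate [f_j] to a vector [x j] of norm at most
    [f_j] which almost attains both [c j * f_j] under [psi] and
    [f_j + s * |x0 j|] in norm for all [s >= 0] at once
    ([daugavet_slice_scaled]); the losses are multiplicative, hence uniform in
    [j], and the vectors [x j] assemble to the required element of the sum.
    The sum in [g] is finite, so no convergence question arises for it: the
    coordinates beyond [n] only add nonnegative terms to [psi x], and the bound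
    on the norm in the lift holds for every [s >= 0]. *)

(** * Hahn-Banach for sublinear functionals *)
Lemma scalar_ex (R : realType) (V : lmodType R) (f : V -> R) :
  scalar f -> exists phi : {scalar V}, forall x, phi x = f x.
Proof.
move=> fl; pose g := f; pose h := GRing.isLinear.Build R V R *%R g fl.
by exists (HB.pack g h : {scalar V}).
Qed.

Lemma linear_ex (R : realType) (V W : lmodType R) (f : V -> W) :
  linear f -> exists T : {linear V -> W}, forall x, T x = f x.
Proof.
move=> fl; pose g := f; pose h := GRing.isLinear.Build R V W *:%R g fl.
by exists (HB.pack g h : {linear V -> W}).
Qed.

Section hahn_banach.
Variables (R : realType) (V : lmodType R).
Implicit Types p q : V -> R.

Definition sublinear p :=
  (forall x y, p (x + y) <= p x + p y) /\
  (forall t x, 0 <= t -> p (t *: x) = t * p x).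

Lemma sublinear0 p : sublinear p -> p 0 = 0.
Proof. by move=> [_ pZ]; rewrite -(scale0r 0) pZ// mul0r. Qed.

Lemma sublinear_opp p x : sublinear p -> - p (- x) <= p x.
Proof.
by move=> sp; have := sp.1 x (- x); rewrite subrr sublinear0// -lerBlDr sub0r.
Qed.

Lemma sublinear_le p : (forall x y, p (x + y) <= p x + p y) ->
  (forall t x, 0 <= t -> p (t *: x) <= t * p x) -> sublinear p.
Proof.
move=> pD pZ; split=> // t x; rewrite le_eqVlt => /predU1P[<-|t0].
  apply/eqP; rewrite scale0r mul0r eq_le; apply/andP; split.
    by have := pZ 0 0 (lexx _); rewrite scale0r mul0r.
  by have := pD 0 0; rewrite addr0; lra.
apply/eqP; rewrite eq_le (pZ _ _ (ltW t0))/= -ler_pdivlMl//.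
rewrite -[in leLHS](scale1r x) -(mulVf (lt0r_neq0 t0)) -scalerA.
by rewrite pZ// invr_ge0 ltW.
Qed.

Lemma le_inf_add (A B : set R) c : A !=set0 -> B !=set0 ->
  (forall a b, A a -> B b -> c <= a + b) -> c <= inf A + inf B.
Proof.
move=> A0 B0 cAB; rewrite -lerBlDr; apply: lb_le_inf => // a Aa.
rewrite lerBlDr -lerBlDl; apply: lb_le_inf => // b Bb.
by rewrite lerBlDl; exact: cAB.
Qed.

(** [slide p y] is the largest sublinear functional [q <= p] with
    [q (- y) <= - p y]: it pushes [p] towards being odd at [y]. *)
Definition slide_values p y x :=
  [set p (x + t *: y) - t * p y | t in [set t : R | 0 <= t]].

Definition slide p y x := inf (slide_values p y x).

Lemma slide_values_nonempty p y x : slide_values p y x !=set0.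
Proof. by exists (p (x + 0 *: y) - 0 * p y), 0 => /=. Qed.

Lemma slide_le p y x t : sublinear p -> 0 <= t ->
  slide p y x <= p (x + t *: y) - t * p y.
Proof.
move=> sp t0; apply: ge_inf; last by exists t.
exists (- p (- x)) => _ [s /= s0 <-].
rewrite lerBrDr -[s * _]sp.2//.
have := sp.1 (x + s *: y) (- x); rewrite addrAC subrr add0r; lra.
Qed.

Lemma slide_le_self p y x : sublinear p -> slide p y x <= p x.
Proof.
by move=> sp; have := slide_le y x sp (lexx 0); rewrite scale0r addr0 mul0r subr0.
Qed.

Lemma slide_opp p y : sublinear p -> slide p y (- y) <= - p y.
Proof.
move=> sp; have := slide_le y (- y) sp ler01.
by rewrite scale1r addNr sublinear0// mul1r sub0r.
Qed.

Lemma slide_sublinear p y : sublinear p -> sublinear (slide p y).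
Proof.
move=> sp; apply: sublinear_le => [x x'|r x].
  apply: le_inf_add; [exact: slide_values_nonempty..|].
  move=> _ _ [s /= s0 <-] [t /= t0 <-].
  rewrite (le_trans (slide_le y (x + x') sp (addr_ge0 s0 t0)))//.
  by have := sp.1 (x + s *: y) (x' + t *: y); rewrite addrACA -scalerDl; lra.
rewrite le_eqVlt => /predU1P[<-|r0].
  by rewrite scale0r mul0r -(sublinear0 sp) slide_le_self.
rewrite -ler_pdivrMl//; apply: lb_le_inf; first exact: slide_values_nonempty.
move=> _ [t /= t0 <-]; rewrite ler_pdivrMl//.
have := slide_le y (r *: x) sp (mulr_ge0 (ltW r0) t0).
by rewrite -scalerA -scalerDr (sp.2 _ _ (ltW r0)) mulrBr mulrA.
Qed.

(** A minimal [p] coincides with [slide p y] for every [y], so it is odd; and a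
    sublinear functional that is odd is linear. *)
Lemma minimal_sublinear_linear p : sublinear p ->
  (forall q, sublinear q -> (forall x, q x <= p x) -> forall x, p x <= q x) ->
  scalar p.
Proof.
move=> sp pmin.
have pN y : p (- y) = - p y.
  apply/eqP; rewrite eq_le; apply/andP; split; last first.
    by have := sublinear_opp y sp; lra.
  apply: le_trans (slide_opp y sp).
  by apply: pmin; [exact: slide_sublinear|move=> x; exact: slide_le_self].
have pZ t x : p (t *: x) = t * p x.
  have [/sp.2//|t0] := leP 0 t.
  by rewrite -[t]opprK scaleNr pN sp.2 ?mulNr// oppr_ge0 ltW.
move=> t x y; rewrite -pZ; apply/eqP; rewrite eq_le sp.1/=.
by have := sp.1 (t *: x + y) (- y); rewrite addrK pN; lra.
Qed.

(** The pointwise infimum of a chain of sublinear functionals is sublinear, so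
    Zorn's lemma provides a minimal sublinear functional below [q], which is
    linear.  Minimising over functionals defined on the whole space avoids
    extending partially defined ones. *)
Theorem hahn_banach q : sublinear q ->
  exists phi : {scalar V}, forall x, phi x <= q x.
Proof.
move=> sq.
pose S := {p | sublinear p /\ forall x, p x <= q x}.
pose below (p p' : S) := `[< forall x, sval p' x <= sval p x >].
have qS : sublinear q /\ forall x, q x <= q x by split.
have [|||[p [sp pq]] pmax] := @ZL_preorder S (exist _ q qS) below.
- by move=> p; apply/asboolP.
- move=> p p' p'' /asboolP pp' /asboolP pp''; apply/asboolP => x.
  exact: le_trans (pp'' x) (pp' x).
- move=> A Atot.
  have [[p0 Ap0]|A0] := pselect (A !=set0); last first.
    by exists (exist _ q qS) => s As; exfalso; apply: A0; exists s.
  pose B x := [set sval p x | p in A].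
  have B0 x : B x !=set0 by exists (sval p0 x), p0.
  have infB x (p : S) : A p -> inf (B x) <= sval p x.
    move=> Ap; apply: ge_inf; last by exists p.
    (* uniform in [p']: [- q (- x) <= - p' (- x) <= p' x] *)
    exists (- q (- x)) => _ [[p' [sp' p'q]] _ <-] /=.
    by rewrite (le_trans _ (sublinear_opp x sp'))// lerN2.
  have sB : sublinear (fun x => inf (B x)).
    apply: sublinear_le => [x y|t x].
      apply: le_inf_add => // _ _ [p Ap <-] [p' Ap' <-].
      have [/asboolP pp'|/asboolP pp'] := Atot _ _ Ap Ap'.
        apply: (le_trans (infB (x + y) _ Ap')).
        apply: (le_trans ((svalP p').1.1 x y)).
        by rewrite lerD2r; exact: pp'.
      apply: (le_trans (infB (x + y) _ Ap)).
      apply: (le_trans ((svalP p).1.1 x y)).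
      by rewrite lerD2l; exact: pp'.
    rewrite le_eqVlt => /predU1P[<-|t0].
      rewrite scale0r mul0r -[leRHS](sublinear0 (svalP p0).1); exact: infB.
    rewrite -ler_pdivrMl//; apply: lb_le_inf => // _ [p Ap <-].
    rewrite ler_pdivrMl// -((svalP p).1.2 _ _ (ltW t0)); exact: infB.
  have Bq x : inf (B x) <= q x.
    exact: le_trans (infB x _ Ap0) ((svalP p0).2 x).
  have BS : sublinear (fun x => inf (B x)) /\ forall x, inf (B x) <= q x by [].
  exists (exist _ (fun x => inf (B x)) BS) => p Ap; apply/asboolP => x /=.
  exact: infB.
- have /scalar_ex[phi phiE] : scalar p.
    apply: minimal_sublinear_linear => // r sr rp.
    have rS : sublinear r /\ forall x, r x <= q x.
      by split=> // x; exact: le_trans (rp x) (pq x).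
    by apply/asboolP/(pmax (exist _ r rS))/asboolP.
  by exists phi => x; rewrite phiE.
Qed.

End hahn_banach.

(** Any linear functional below [slide norm v] is below the norm and at most
    [- |v|] at [- v]. *)
Lemma norming_functional (R : realType) (V : normedModType R) (v : V) :
  exists2 phi : {scalar V}, (forall x, `|phi x| <= `|x|) & phi v = `|v|.
Proof.
have sn : sublinear (fun x : V => `|x|).
  by split=> [x y|t x t0]; [exact: ler_normD|rewrite normrZ ger0_norm].
have [phi phis] := hahn_banach (slide_sublinear v sn).
have phin x : phi x <= `|x| by exact: le_trans (phis x) (slide_le_self v x sn).
exists phi => [x|].
  by rewrite ler_norml phin andbT lerNl -raddfN -(normrN x) phin.
apply/eqP; rewrite eq_le phin/= -lerN2 -raddfN.
exact: le_trans (phis _) (slide_opp v sn).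
Qed.

(** * The Daugavet equation for an operator of rank one *)
Section bounded_maps.
Variables (R : realType) (V W : normedModType R).

Lemma bounded_nearP (T : {linear V -> W}) :
  bounded_near T (nbhs 0) <-> exists M, forall x, `|T x| <= M * `|x|.
Proof.
rewrite linear_boundedP; split=> [[M [_ /(_ (M + 1))TM]]|[M TM]].
  by exists (M + 1); apply: TM; rewrite ltrDl.
exists M; split=> [|r /ltW Mr x]; first exact: num_real.
by rewrite (le_trans (TM x))// ler_wpM2r.
Qed.

Variables (f : V -> W) (M : R).
Hypothesis fM : forall x, `|f x| <= M * `|x|.

Let values : set R := [set `|f x| | x in [set x : V | `|x| <= 1]].

Let values0 : values !=set0.
Proof. by exists `|f 0|, 0; rewrite //= normr0. Qed.

Lemma le_opnorm x : `|x| <= 1 -> `|f x| <= opnorm f.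
Proof.
move=> x1; apply: ub_le_sup; last by exists x.
exists `|M| => _ [y /= y1 <-]; rewrite (le_trans (fM y))//.
rewrite (le_trans (ler_wpM2r _ (ler_norm M)))//.
by rewrite -[leRHS]mulr1 ler_wpM2l.
Qed.

Lemma opnorm_le c : (forall x, `|x| <= 1 -> `|f x| <= c) -> opnorm f <= c.
Proof. by move=> fc; apply: ge_sup => // _ [x /= x1 <-]; exact: fc. Qed.

Lemma lt_opnorm c : c < opnorm f -> exists2 x, `|x| <= 1 & c < `|f x|.
Proof. by move=> /(sup_gt values0)[_ [x /= x1 <-] cx]; exists x. Qed.

Lemma opnorm_ge0 : 0 <= opnorm f.
Proof. by apply: le_trans (le_opnorm (x := 0) _); rewrite ?normr0. Qed.

End bounded_maps.

(** The inequality [<=] in the Daugavet equation is the triangle inequality;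
    what remains says that [|x + f x|] exceeds every number below
    [1 + |f z|]. *)
Lemma daugavet_equationP (R : realType) (V : normedModType R) (f : V -> V) M :
  (forall x, `|f x| <= M * `|x|) ->
  opnorm (fun x => x + f x) = 1 + opnorm f <->
  forall z, `|z| <= 1 -> forall r, 0 < r ->
    exists2 x, `|x| <= 1 & 1 + `|f z| - r <= `|x + f x|.
Proof.
move=> fM.
have gM x : `|x + f x| <= (1 + M) * `|x|.
  by rewrite mulrDl mul1r (le_trans (ler_normD _ _))// lerD2l.
split=> [fE z z1 r r0|fE].
  have /lt_opnorm[x x1 /ltW] : 1 + `|f z| - r < opnorm (fun x => x + f x).
    by rewrite fE; have := le_opnorm fM z1; lra.
  by exists x.
apply/eqP; rewrite eq_le; apply/andP; split.
  apply: opnorm_le => x x1; rewrite (le_trans (ler_normD _ _))// lerD//.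
  exact: le_opnorm fM _ x1.
rewrite -lerBrDl; apply: opnorm_le => z z1.
apply/ler_addgt0Pr => r r0; have [x x1 xz] := fE z z1 r r0.
by have := le_opnorm gM x1; lra.
Qed.

Section tensors.
Variables (R : realType) (V W : normedModType R).

Lemma rank_one_neq0 (T : {linear V -> W}) : rank_one T -> exists x, T x != 0.
Proof.
move=> [y y0 Ty]; have [x _ Tx] : range T y by rewrite Ty; exists 1; rewrite ?scale1r.
by exists x; rewrite Tx.
Qed.

Lemma rank_one_tensor (T : {linear V -> W}) u : rank_one T -> T u != 0 ->
  exists phi : {scalar V}, forall x, T x = phi x *: T u.
Proof.
move=> [y y0 Ty] Tu0.
have Trange x : exists c, T x = c *: y.
  have [c _ <-] : range (fun c => c *: y) (T x) by rewrite -Ty; exists x.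
  by exists c.
have [k Tuk] := Trange u.
have k0 : k != 0 by apply: contra Tu0 => /eqP k0; rewrite Tuk k0 scale0r.
have /choice[f fT] : forall x, exists c, T x = c *: T u.
  move=> x; have [c ->] := Trange x.
  by exists (c / k); rewrite Tuk scalerA divfK.
have /scalar_ex[phi phiE] : scalar f.
  move=> a x x'; apply/eqP; rewrite -subr_eq0.
  have := scaler_eq0 (f (a *: x + x') - (a * f x + f x')) (T u).
  rewrite (negbTE Tu0) orbF => <-.
  by rewrite scalerBl scalerDl -scalerA -!fT linearP subrr.
by exists phi => x; rewrite phiE fT.
Qed.

Lemma tensor_rank_one (phi : {scalar V}) (y : W) z : phi z != 0 -> y != 0 ->
  exists2 T : {linear V -> W}, rank_one T & forall x, T x = phi x *: y.
Proof.
move=> phiz y0.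
have /linear_ex[T TE] : linear (fun x => phi x *: y).
  by move=> a x x'; rewrite linearP scalerDl scalerA.
exists T => //; exists y => //; apply/seteqP; split=> _ [x _ <-].
  by exists (phi x) => //; rewrite TE.
by exists ((x / phi z) *: z) => //; rewrite TE linearZ/= divfK.
Qed.

End tensors.

(** The Daugavet equation [|Id + phi (x) y| = 1 + |phi|], for [|y| = 1],
    expressed by points of the unit ball instead of suprema. *)
Definition tensor_daugavet (R : realType) (V : normedModType R)
    (phi : V -> R) (y : V) :=
  forall z, `|z| <= 1 -> forall r, 0 < r ->
    exists2 x, `|x| <= 1 & 1 + `|phi z| - r <= `|x + phi x *: y|.

Section tensor_equation.
Variables (R : realType) (V : normedModType R).
Variables (phi : {scalar V}) (y : V).
Hypothesis y1 : `|y| = 1.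

Lemma tensor_daugavetP (T : {linear V -> V}) : (forall x, T x = phi x *: y) ->
  bounded_near T (nbhs 0) ->
  (opnorm (fun x => x + T x) = 1 + opnorm T <-> tensor_daugavet phi y).
Proof.
move=> TE /bounded_nearP[M TM]; rewrite (daugavet_equationP TM).
have TzE z : `|T z| = `|phi z| by rewrite TE normrZ y1 mulr1.
split=> h z z1 r r0; have [x x1 xz] := h z z1 r r0; exists x => //.
  by rewrite -TzE -TE.
by rewrite TzE TE.
Qed.

(** The pair [(phi, y)] with [phi = 0] is not an operator of rank one, but it
    satisfies [tensor_daugavet] trivially, with [x = y]. *)
Lemma tensor_daugavet_from_operator M : (forall x, `|phi x| <= M * `|x|) ->
  (forall T : {linear V -> V}, (forall x, T x = phi x *: y) ->
    bounded_near T (nbhs 0) -> rank_one T ->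
    opnorm (fun x => x + T x) = 1 + opnorm T) ->
  tensor_daugavet phi y.
Proof.
move=> phiM H; have [[z phiz]|phi0] := pselect (exists z, phi z != 0).
  have y0 : y != 0 by rewrite -normr_eq0 y1 oner_eq0.
  have [T T1 TE] := tensor_rank_one phiz y0.
  have Tb : bounded_near T (nbhs 0).
    by apply/bounded_nearP; exists M => x; rewrite TE normrZ y1 mulr1.
  by apply/(tensor_daugavetP TE) => //; exact: H.
have {}phi0 x : phi x = 0.
  by apply/eqP; apply: contra_notT phi0 => phix; exists x.
move=> z z1 r r0; exists y; rewrite ?y1// !phi0 scale0r addr0 y1 normr0 addr0.
by rewrite lerBlDr lerDl ltW.
Qed.

End tensor_equation.

(** The vector part is taken to be a multiple of the prescribed value [T u], so
    that its sign can be controlled when [T] is positive. *)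
Lemma unit_tensor (R : realType) (V : normedModType R) (T : {linear V -> V}) u :
  bounded_near T (nbhs 0) -> rank_one T -> T u != 0 ->
  exists phi : {scalar V}, [/\ exists M, forall x, `|phi x| <= M * `|x|,
    forall x, T x = phi x *: (`|T u|^-1 *: T u) &
    `|(`|T u|^-1 *: T u)| = 1].
Proof.
move=> /bounded_nearP[M TM] T1 Tu0.
have u0 : `|T u|^-1 != 0 by rewrite invr_eq0 normr_eq0.
have y1 : `|(`|T u|^-1 *: T u)| = 1.
  by rewrite normrZ ger0_norm ?invr_ge0// mulVf// normr_eq0.
have Tv0 : T (`|T u|^-1 *: u) != 0 by rewrite linearZ scaler_eq0 negb_or u0.
have [phi phiE] := rank_one_tensor T1 Tv0; rewrite linearZ in phiE.
exists phi; split => //; exists M => x.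
by rewrite (le_trans _ (TM x))// phiE normrZ y1 mulr1.
Qed.

Lemma daugavetP (R : realType) (X : completeNormedModType R) :
  daugavet X <-> forall (phi : {scalar X}) M y,
    (forall x, `|phi x| <= M * `|x|) -> `|y| = 1 -> tensor_daugavet phi y.
Proof.
split=> [dX phi M y phiM y1|dX T Tb T1].
  by apply: tensor_daugavet_from_operator phiM _ => // T _; exact: dX.
have [u Tu0] := rank_one_neq0 T1.
have [phi [[M phiM] TE y1]] := unit_tensor Tb T1 Tu0.
by apply/(tensor_daugavetP y1 TE Tb); exact: dX phiM y1.
Qed.

(** * The positive Daugavet property of a space with unconditional basis *)
Section lattice.
Variables (R : realType) (F : completeNormedModType R) (N : option nat).
Variable e : unconditional_basis F N.
Implicit Types (x y z : F) (phi : {scalar F}).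

Definition nonneg x := forall j, 0 <= bcoord e x j.

Definition positive_functional (phi : F -> R) :=
  forall x, nonneg x -> 0 <= phi x.

Lemma modulus_ex x :
  exists2 y, forall j, bcoord e y j = `|bcoord e x j| & `|y| = `|x|.
Proof.
have [y yE yx] := basis_unconditional1 (coordP e x).
by exists y => // j; rewrite (coord_expansion yE).
Qed.

Lemma positive_le phi x y : positive_functional phi ->
  (forall j, `|bcoord e x j| <= bcoord e y j) -> `|phi x| <= phi y.
Proof.
move=> phi0 xy; rewrite ler_norml -subr_ge0 opprK -raddfD -[_ <= phi y]subr_ge0.
rewrite -raddfB; apply/andP; split; apply: phi0 => j.
  by rewrite coordD -lerBlDl sub0r (le_trans _ (xy j))// -normrN ler_norm.
by rewrite coordB subr_ge0 (le_trans _ (xy j))// ler_norm.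
Qed.

(** Replacing a witness by its modulus increases [phi x] and all coordinates
    of [x + phi x *: y] in absolute value. *)
Lemma tensor_daugavet_nonneg phi y z r : positive_functional phi -> nonneg y ->
  tensor_daugavet phi y -> `|z| <= 1 -> 0 < r ->
  exists x, [/\ nonneg x, `|x| <= 1 & 1 + `|phi z| - r <= `|x + phi x *: y|].
Proof.
move=> phi0 y0 phiy z1 r0; have [u u1 zu] := phiy z z1 r r0.
have [x xE xu] := modulus_ex u; have x0 : nonneg x by move=> j; rewrite xE.
exists x; rewrite xu; split=> //; apply: (le_trans zu).
apply: (norm_solid (e := e)) => j; rewrite !coordD !coordZ xE.
rewrite [leRHS]ger0_norm ?addr_ge0 ?mulr_ge0 ?phi0//.
rewrite (le_trans (ler_normD _ _))// lerD2l normrM (ger0_norm (y0 j)).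
by rewrite ler_wpM2r// positive_le// => i; rewrite xE.
Qed.

(** If [T] is positive of rank one, some [u >= 0] has [T u <> 0], since
    [u = (|u| + u) - |u|].  Then [T = phi (x) y] with [y] the normalisation of
    [T u], which is nonnegative, and [phi] is positive because the coordinates
    of [T x] are those of [y] multiplied by [phi x]. *)
Lemma positive_daugavetP : positive_daugavet e <->
  forall phi M y, (forall x, `|phi x| <= M * `|x|) -> positive_functional phi ->
    nonneg y -> `|y| = 1 -> tensor_daugavet phi y.
Proof.
split=> [dF phi M y phiM phi0 y0 y1|dF T Tb T1 Tpos].
  apply: tensor_daugavet_from_operator phiM _ => // T TE Tb T1; apply: dF => //.
  by move=> x x0 j; rewrite TE coordZ mulr_ge0// phi0.
have [u u0 Tu0] : exists2 u, nonneg u & T u != 0.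
  have [u Tu0] := rank_one_neq0 T1; have [v vE _] := modulus_ex u.
  have [Tv0|Tv0] := eqVneq (T v) 0; last by exists v => // j; rewrite vE.
  exists (v + u); last by rewrite raddfD/= Tv0 add0r.
  by move=> j; rewrite coordD vE -lerBlDr sub0r -normrN ler_norm.
have [phi [[M phiM] TE y1]] := unit_tensor Tb T1 Tu0.
set y := _ *: T u in TE y1.
have y0 : nonneg y by move=> j; rewrite coordZ mulr_ge0 ?invr_ge0//; exact: Tpos.
have [k yk] : exists k, 0 < bcoord e y k.
  apply: contrapT => yneg; have : y = 0.
    apply: (coord_inj (e := e)); apply/funext => j; rewrite Defs.coord0; apply/eqP.
    rewrite eq_le y0 andbT leNgt; apply/negP => yj; apply: yneg; by exists j.
  by move=> y_0; move: y1; rewrite y_0 normr0 => /esym/eqP; rewrite oner_eq0.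
apply/(tensor_daugavetP y1 TE Tb); apply: dF phiM _ y0 y1 => x x0.
by have := Tpos x x0 k; rewrite TE coordZ pmulr_lge0.
Qed.

End lattice.

(** * From the sum to the basis space *)
Section Fsum_elements.
Variables (R : realType) (F : completeNormedModType R) (N : option nat).
Variables (e : unconditional_basis F N).
Variable X : basis_index N -> completeNormedModType R.
Implicit Types (x : Fsum e X) (f : F).

Lemma Fsum_ex (u : forall j, X j) f : (forall j, `|u j| <= bcoord e f j) ->
  exists x, forall j, x j = u j.
Proof. by move=> /Fsum_dominated uF; exists (MkFsum uF). Qed.

Lemma Fsum_norm_le x f : (forall j, `|x j| <= `|bcoord e f j|) -> `|x| <= `|f|.
Proof.
move=> xf; rewrite Fsum_normE; apply: (norm_solid (e := e)) => j.
by rewrite coord_Fsum_abs normr_id.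
Qed.

Lemma Fsum_norm_ge x f : (forall j, `|bcoord e f j| <= `|x j|) -> `|f| <= `|x|.
Proof.
move=> xf; rewrite Fsum_normE; apply: (norm_solid (e := e)) => j.
by rewrite coord_Fsum_abs normr_id.
Qed.

(** Unit vectors [v j] embed [F] isometrically into the sum. *)
Lemma Fsum_scaled (v : forall j, X j) f : (forall j, `|v j| = 1) ->
  exists x, (forall j, x j = bcoord e f j *: v j) /\ `|x| = `|f|.
Proof.
move=> v1; have [g gE _] := modulus_ex e f.
have [|x xE] := @Fsum_ex (fun j => bcoord e f j *: v j) g.
  by move=> j; rewrite normrZ v1 mulr1 gE.
exists x; split=> //; apply/eqP; rewrite eq_le Fsum_norm_le ?Fsum_norm_ge// => j;
  by rewrite xE normrZ v1 mulr1.
Qed.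

End Fsum_elements.

(** The functionals [n j] need norm one so that [psi] is dominated by [phi] of
    the moduli, and value one at [v j] so that [psi] is not smaller than [phi]
    on the embedded copy of [F]. *)
Theorem positive_daugavet_of_Fsum (R : realType) (F : completeNormedModType R)
    (N : option nat) (e : unconditional_basis F N)
    (X : basis_index N -> completeNormedModType R) :
  (forall j, exists x : X j, x != 0) ->
  daugavet (Fsum e X) -> positive_daugavet e.
Proof.
move=> X0 /daugavetP dX; apply/positive_daugavetP => phi M y phiM phi0 y0 y1.
have : forall j, exists v : X j, `|v| = 1.
  move=> j; have [v v0] := X0 j; exists (`|v|^-1 *: v).
  by rewrite normrZ ger0_norm ?invr_ge0// mulVf// normr_eq0.
move=> /(_ _)/cid-/all_sig[v v1].
have : forall j, exists n : {scalar X j},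
    (forall x, `|n x| <= `|x|) /\ n (v j) = 1.
  by move=> j; have [n nx nv] := norming_functional (v j); exists n; rewrite nv v1.
move=> /(_ _)/cid-/all_sig[n nP].
have /choice[h hE] : forall x : Fsum e X, exists f : F,
    forall j, bcoord e f j = n j (x j).
  move=> x; have [|f fE _] := solid (b := fun j => n j (x j)) (coordP e (Fsum_abs x)).
    by move=> j; rewrite coord_Fsum_abs normr_id (nP j).1.
  by exists f => j; rewrite (coord_expansion fE).
have hx x : `|h x| <= `|x|.
  by apply: Fsum_norm_ge => j; rewrite hE (nP j).1.
have /scalar_ex[psi psiE] : scalar (fun x => phi (h x)).
  move=> a x x'; rewrite -linearP; congr (phi _).
  apply: (coord_inj (e := e)); apply/funext => j.
  by rewrite coordD coordZ !hE linearP.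
have M0 : 0 <= M by have := phiM y; rewrite y1 mulr1; apply: le_trans.
have psiM x : `|psi x| <= M * `|x|.
  by rewrite psiE (le_trans (phiM _))// ler_wpM2l.
have [x0 [x0E x01]] := Fsum_scaled e y v1; rewrite y1 in x01.
move=> z z1 r r0; have [f fE fz] := modulus_ex e z.
have [z' [z'E z'1]] := Fsum_scaled e f v1.
have hz' : h z' = f.
  apply: (coord_inj (e := e)); apply/funext => j.
  by rewrite hE z'E linearZ/= (nP j).2 mulr1.
rewrite -z'1 in fz; rewrite -fz in z1.
have [x x1 xr] := dX psi M x0 psiM x01 z' z1 r r0.
exists (Fsum_abs x) => //.
apply: le_trans (le_trans xr _).
  rewrite lerB// lerD2l psiE hz' (le_trans _ (ler_norm _))//.
  by apply: positive_le phi0 _ => j; rewrite fE.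
apply: Fsum_norm_le => j; rewrite coordD coordZ coord_Fsum_abs /=.
rewrite [leRHS]ger0_norm; last first.
  by rewrite addr_ge0 ?mulr_ge0 ?phi0// => i; rewrite coord_Fsum_abs.
rewrite (le_trans (ler_normD _ _))// lerD2l normrZ x0E normrZ v1 mulr1.
rewrite (ger0_norm (y0 j)) ler_wpM2r// psiE.
by apply: positive_le phi0 _ => i; rewrite coord_Fsum_abs hE (nP i).1.
Qed.

(** * Slices of the unit ball of a space with the Daugavet property *)
Section slices.
Variables (R : realType) (X : completeNormedModType R).
Implicit Types (x v u : X) (phi : {scalar X}).

Definition dual_norm (phi : X -> R) : R := opnorm (W := R^o) phi.

Lemma dual_norm_ge0 phi M : (forall x, `|phi x| <= M * `|x|) -> 0 <= dual_norm phi.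
Proof. exact: opnorm_ge0. Qed.

Lemma le_dual_norm phi M x : (forall x, `|phi x| <= M * `|x|) ->
  `|phi x| <= dual_norm phi * `|x|.
Proof.
move=> phiM; have [->|x0] := eqVneq x 0; first by rewrite raddf0 !normr0 mulr0.
have nx0 : 0 < `|x| by rewrite normr_gt0.
rewrite -ler_pdivrMr//.
have -> : `|phi x| / `|x| = `|phi (`|x|^-1 *: x)|.
  by rewrite linearZ/= normrM ger0_norm ?invr_ge0// mulrC.
apply: (le_opnorm (W := R^o) phiM).
by rewrite normrZ ger0_norm ?invr_ge0// mulVf// lt0r_neq0.
Qed.

(** If [x] and [v] almost point in the same direction then the triangle
    inequality is almost sharp for all their nonnegative combinations.  For
    [s <= t] this follows from [t *: (x + v) = (t *: x + s *: v) + (t - s) *: v]. *)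
Lemma norm_add_scaled x v r t s : `|x| <= 1 -> `|v| <= 1 -> 0 <= r ->
  2 - r <= `|x + v| -> 0 <= t -> 0 <= s ->
  (1 - r) * (t + s) <= `|t *: x + s *: v|.
Proof.
wlog st : x v t s / s <= t => [W|] x1 v1 r0 xv t0 s0.
  have [/W|/ltW ts] := leP s t; first by apply.
  by rewrite [t + s]addrC [t *: x + _]addrC W// [v + x]addrC.
have tE : t *: (x + v) = (t *: x + s *: v) + (t - s) *: v.
  by rewrite -addrA -scalerDl [s + _]addrC subrK scalerDr.
have /le_trans/(_ (ler_normD _ _)) : t * (2 - r) <= `|(t *: x + s *: v) + (t - s) *: v|.
  by rewrite -tE normrZ ger0_norm// ler_wpM2l.
rewrite normrZ [`|t - s|]ger0_norm ?subr_ge0// => h.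
have : (t - s) * `|v| <= t - s by rewrite -[leRHS]mulr1 ler_wpM2l ?subr_ge0.
have : 0 <= r * s by exact: mulr_ge0.
lra.
Qed.

(** The Daugavet equation for [psi (x) v], where [psi] is [phi] normalised,
    gives [x] with [|x + psi x *: v|] close to 2; this forces [psi x] close to 1,
    after a change of sign of [x], and then [x + v] is close to
    [x + psi x *: v]. *)
Lemma daugavet_slice phi M v r : daugavet X ->
  (forall x, `|phi x| <= M * `|x|) -> `|v| = 1 -> 0 < r ->
  exists x, [/\ `|x| <= 1, 2 - r <= `|x + v| & (1 - r) * dual_norm phi <= phi x].
Proof.
move=> /daugavetP dX phiM v1 r0; set c := dual_norm phi.
have phic x : `|phi x| <= c * `|x| by exact: le_dual_norm phiM.
have := dual_norm_ge0 phiM; rewrite -/c le_eqVlt => /predU1P[c0|c0].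
  exists v; split; first by rewrite v1.
    have -> : v + v = 2 *: v by rewrite scaler_nat mulr2n.
    by rewrite normrZ v1 mulr1 normr_nat; lra.
  have := phic v; rewrite -c0 mul0r mulr0 normr_le0 => /eqP ->.
  exact: lexx.
have /scalar_ex[psi psiE] : scalar (fun x => c^-1 * phi x).
  by move=> a x y; rewrite linearP/= mulrDr mulrCA.
have psi1 x : `|psi x| <= 1 * `|x|.
  by rewrite psiE normrM ger0_norm ?invr_ge0 ?(ltW c0)// ler_pdivrMl// mul1r.
(* [r] is spent on [|psi z|], on the equation, and on replacing [psi x] by 1. *)
have q0 : 0 < r / 4 by rewrite divr_gt0.
have [z z1 cz] : exists2 z, `|z| <= 1 & c * (1 - r / 4) < `|phi z|.
  by apply: (lt_opnorm (W := R^o)); rewrite -/(dual_norm phi) -/c gtr_pMr//; lra.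
have psiz : 1 - r / 4 < `|psi z|.
  by rewrite psiE normrM ger0_norm ?invr_ge0 ?(ltW c0)// ltr_pdivlMl.
have [x [x1 x0 xz]] : exists x, [/\ `|x| <= 1, 0 <= psi x &
    1 + `|psi z| - r / 4 <= `|x + psi x *: v|].
  have [x x1 xz] := dX psi 1 v psi1 v1 z z1 _ q0.
  have [x0|x0] := leP 0 (psi x); first by exists x.
  exists (- x); split; rewrite ?normrN// raddfN ?oppr_ge0 ?(ltW x0)//.
  by rewrite scaleNr -opprD normrN.
have psix : `|x + psi x *: v| <= 1 + psi x.
  by rewrite (le_trans (ler_normD _ _))// normrZ v1 mulr1 ger0_norm// lerD2r.
have psix1 : psi x <= 1.
  by rewrite (le_trans (ler_norm _))// (le_trans (psi1 x))// mul1r.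
exists x; split=> //; last first.
  have : 1 - r <= psi x by lra.
  by rewrite psiE ler_pdivlMl// mulrC.
have : `|x + psi x *: v| <= `|x + v| + (1 - psi x).
  have -> : x + psi x *: v = (x + v) + (psi x - 1) *: v.
    by rewrite scalerBl scale1r -addrA [v + _]addrC subrK.
  rewrite (le_trans (ler_normD _ _))// lerD2l normrZ v1 mulr1 distrC.
  by rewrite ger0_norm// subr_ge0.
lra.
Qed.

(** The same vector [x] serves all [s] at once, and the factor [1 - r] does not
    depend on the sizes of [t] and [u]; this makes the lemma usable in
    infinitely many summands simultaneously. *)
Lemma daugavet_slice_scaled phi M u t r : daugavet X -> (exists x : X, x != 0) ->
  (forall x, `|phi x| <= M * `|x|) -> 0 <= t -> 0 < r ->
  exists x, [/\ `|x| <= t,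
    forall s, 0 <= s -> (1 - r) * (t + s * `|u|) <= `|x + s *: u| &
    (1 - r) * (dual_norm phi * t) <= phi x].
Proof.
move=> dX [w w0] phiM t0 r0.
have [v v1 uE] : exists2 v, `|v| = 1 & u = `|u| *: v.
  have [->|u0] := eqVneq u 0.
    exists (`|w|^-1 *: w); last by rewrite normr0 scale0r.
    by rewrite normrZ ger0_norm ?invr_ge0// mulVf// normr_eq0.
  exists (`|u|^-1 *: u); last by rewrite scalerA mulfV ?scale1r// normr_eq0.
  by rewrite normrZ ger0_norm ?invr_ge0// mulVf// normr_eq0.
have [x [x1 xv phix]] := daugavet_slice dX phiM v1 r0.
exists (t *: x); split.
- by rewrite normrZ ger0_norm// -[leRHS]mulr1 ler_wpM2l.
- move=> s s0; rewrite [in leRHS]uE scalerA.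
  by apply: norm_add_scaled => //; rewrite ?v1 ?(ltW r0) ?mulr_ge0.
- by rewrite linearZ/= mulrA [leRHS]mulrC ler_wpM2r.
Qed.

End slices.

(** * Coordinate expansions in the sum *)
Section index_sums.
Variables (N : option nat) (V : nmodType).
Implicit Type f : basis_index N -> V.

(** A family over the index set of a basis is extended by 0 past a finite basis,
    in the same way as [basis_term]. *)
Definition index_term f (i : nat) : V := if insub i is Some j then f j else 0.

Definition index_sum f n := \sum_(0 <= i < n) index_term f i.

Lemma index_sumS f n : index_sum f n.+1 = index_sum f n + index_term f n.
Proof. by rewrite /index_sum big_nat_recr. Qed.

Lemma index_sum0 f : index_sum f 0 = 0.
Proof. by rewrite /index_sum big_nil. Qed.

Lemma index_sum_single f k n : (forall j, j != k -> f j = 0) ->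
  index_sum f n = if (val k < n)%N then f k else 0.
Proof.
move=> fk; elim: n => [|n IHn]; first exact: index_sum0.
rewrite index_sumS IHn /index_term ltnS [(val k <= n)%N]leq_eqVlt.
case: insubP => [j _ jn|nN].
  rewrite -jn; have [->|jk] := eqVneq j k; first by rewrite eqxx ltnn add0r.
  by rewrite (fk j jk) addr0 val_eqE eq_sym (negbTE jk).
rewrite addr0 (negbTE (_ : val k != n))//.
by apply: contra nN => /eqP <-; exact: valP k.
Qed.

End index_sums.

Lemma raddf_index_sum (N : option nat) (V W : nmodType) (h : V -> W)
    (f : basis_index N -> V) n : h 0 = 0 -> {morph h : x y / x + y} ->
  h (index_sum f n) = index_sum (fun j => h (f j)) n.
Proof.
move=> h0 hD; rewrite /index_sum (big_morph h hD h0); apply: eq_bigr => i _.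
by rewrite /index_term; case: insub.
Qed.

Lemma le_index_sum (R : numDomainType) (N : option nat)
    (f g : basis_index N -> R) n : (forall j, f j <= g j) ->
  index_sum f n <= index_sum g n.
Proof.
move=> fg; apply: ler_sum => i _; rewrite /index_term.
by case: insub.
Qed.

Lemma norm_index_sum (R : numDomainType) (N : option nat)
    (f : basis_index N -> R) n : `|index_sum f n| <= index_sum (fun j => `|f j|) n.
Proof.
apply: (le_trans (ler_norm_sum _ _ _)); apply: ler_sum => i _; rewrite /index_term.
by case: insub; rewrite ?normr0.
Qed.

Section Fsum_expansion.
Variables (R : realType) (F : completeNormedModType R) (N : option nat).
Variables (e : unconditional_basis F N).
Variable X : basis_index N -> completeNormedModType R.
Local Notation FX := (Fsum e X).
Implicit Types (x : FX) (psi : {scalar FX}).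

Lemma coord_single k j i : bcoord e (k *: e j) i = if i == j then k else 0.
Proof. by rewrite (coord_expansion (@expansion_single _ _ _ e j k)). Qed.

Lemma coord_index_sum a n k : bcoord e (index_sum (fun j => a j *: e j) n) k =
  if (val k < n)%N then a k else 0.
Proof.
rewrite (raddf_index_sum (h := fun u : F => bcoord e u k)).
- rewrite (index_sum_single (k := k)) => [|j jk].
    by rewrite coord_single eqxx.
  by rewrite coord_single eq_sym (negbTE jk).
- exact: Defs.coord0.
- by move=> u w; exact: coordD.
Qed.

Lemma Fsum_inj_ex j : exists I : {linear X j -> FX},
  forall v i, I v i = dfwith (fun=> 0) j v i.
Proof.
have dfE (v : X j) i : `|dfwith (fun i => 0 : X i) j v i| =
    if i == j then `|v| else 0.
  have [->|ij] := eqVneq i j; first by rewrite dfwithin.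
  by rewrite dfwithout ?normr0// eq_sym.
have /choice[I IE] : forall v : X j, exists x : FX,
    forall i, x i = dfwith (fun=> 0) j v i.
  move=> v; apply: (Fsum_ex (f := `|v| *: e j)) => i.
  by rewrite coord_single dfE.
have /linear_ex[J JE] : linear I.
  move=> a v w; apply: Fsum_ext => i /=; rewrite !IE.
  have [<-|ji] := eqVneq j i; first by rewrite !dfwithin.
  by rewrite !dfwithout// scaler0 addr0.
by exists J => v i; rewrite JE IE.
Qed.

Definition Fsum_inj j : {linear X j -> FX} := sval (cid (Fsum_inj_ex j)).

Lemma Fsum_injE j v i : Fsum_inj j v i = dfwith (fun=> 0) j v i.
Proof. by rewrite /Fsum_inj; case: cid. Qed.

Lemma Fsum_inj_norm j v : `|Fsum_inj j v| <= `|v|.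
Proof.
rewrite -[leRHS]mulr1 -(basis_normalised e j) -[`|v|]normr_id -normrZ.
apply: Fsum_norm_le => i.
rewrite coord_single Fsum_injE.
have [->|ij] := eqVneq i j; first by rewrite dfwithin normr_id.
by rewrite dfwithout ?normr0// eq_sym.
Qed.

Definition Fsum_partial x n := index_sum (fun j => Fsum_inj j (x j)) n.

Lemma Fsum_partialE x n k : Fsum_partial x n k = if (val k < n)%N then x k else 0.
Proof.
rewrite (raddf_index_sum (h := fun x : FX => x k))//.
rewrite (index_sum_single (k := k)) => [|j jk].
  by rewrite Fsum_injE dfwithin.
by rewrite Fsum_injE dfwithout.
Qed.

(** The tails of [x] have the same norms as the tails of the basis expansion of
    [(|x j|)_j]. *)
Lemma Fsum_partial_cvg x : Fsum_partial x n @[n --> \oo] --> x.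
Proof.
apply/cvgrPdist_le => r r0.
have /cvgrPdist_le/(_ r r0) := coordP e (Fsum_abs x).
apply: filterS => n; apply: le_trans; apply: Fsum_norm_le => j.
rewrite FsumB Fsum_partialE coordB.
rewrite (coord_index_sum (bcoord e (Fsum_abs x)) n j) coord_Fsum_abs.
by case: ifP => _; rewrite ?subrr ?normr0// !subr0 normr_id.
Qed.

Lemma scalar_partial_cvg psi M x : (forall x, `|psi x| <= M * `|x|) ->
  index_sum (fun j => psi (Fsum_inj j (x j))) n @[n --> \oo] --> psi x.
Proof.
move=> psiM; apply/cvgrPdist_le => r r0.
have M0 : 0 < `|M| + 1 by rewrite ltr_wpDl.
have /cvgrPdist_le/(_ (r / (`|M| + 1))) := @Fsum_partial_cvg x.
move=> /(_ (divr_gt0 r0 M0)); apply: filterS => n xn.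
rewrite -(raddf_index_sum (h := psi)) ?raddf0//; last exact: raddfD.
rewrite -raddfB (le_trans (psiM _))// (le_trans (_ : _ <= (`|M| + 1) * `|x - Fsum_partial x n|))//.
  by rewrite ler_wpM2r// (le_trans (ler_norm M))// lerDl.
by rewrite mulrC -ler_pdivlMr.
Qed.

Lemma partial_le_scalar psi M x n : (forall x, `|psi x| <= M * `|x|) ->
  (forall j, 0 <= psi (Fsum_inj j (x j))) ->
  index_sum (fun j => psi (Fsum_inj j (x j))) n <= psi x.
Proof.
move=> psiM x0; have c := @scalar_partial_cvg psi M x psiM.
rewrite -(cvg_lim _ c)//; apply: (nondecreasing_cvgn_le _ (cvgP _ c)).
apply/nondecreasing_seqP => i; rewrite index_sumS lerDl /index_term.
by case: insub.
Qed.

Definition weighted_sum (c : basis_index N -> R) n (f : F) : R :=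
  index_sum (fun j => c j * bcoord e f j) n.

Lemma weighted_sum_scalar c n : scalar (weighted_sum c n).
Proof.
move=> a f g; rewrite /weighted_sum /index_sum mulr_sumr -big_split/=.
apply: eq_bigr => i _; rewrite /index_term; case: insub => [j|].
  by rewrite coordD coordZ mulrDr mulrCA.
by rewrite mulr0 addr0.
Qed.

Lemma weighted_sum_bounded c n f : (forall j, 0 <= c j) ->
  `|weighted_sum c n f| <= index_sum c n * `|f|.
Proof.
move=> c0; apply: (le_trans (norm_index_sum _ _)).
rewrite mulrC (raddf_index_sum (h := *%R `|f|)) ?mulr0//; last exact: mulrDr.
apply: le_index_sum => j.
by rewrite normrM ger0_norm// mulrC ler_wpM2r// coord_le_norm.
Qed.

End Fsum_expansion.

(** * From the basis space to the sum *)

(** The losses are: [q] for truncating [psi z], [q] in the equation for [g], and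
    a factor [1 - q] in each of the two estimates of the lift, one for
    [psi x] and one for the norm. *)
Theorem Fsum_daugavet (R : realType) (F : completeNormedModType R)
    (N : option nat) (e : unconditional_basis F N)
    (X : basis_index N -> completeNormedModType R) :
  (forall j, exists x : X j, x != 0) -> (forall j, daugavet (X j)) ->
  positive_daugavet e -> daugavet (Fsum e X).
Proof.
move=> X0 dX /positive_daugavetP dF; apply/daugavetP => psi M x0 psiM x01.
have M0 : 0 <= M by have := psiM x0; rewrite x01 mulr1; apply: le_trans.
have : forall j, exists phi : {scalar X j}, forall v, phi v = psi (Fsum_inj e X j v).
  by move=> j; apply: scalar_ex => a v w; rewrite !linearP.
move=> /(_ _)/cid-/all_sig[phi phiE].
have phiM j v : `|phi j v| <= M * `|v|.
  by rewrite phiE (le_trans (psiM _))// ler_wpM2l// Fsum_inj_norm.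
pose c j := dual_norm (phi j).
have c0 j : 0 <= c j by exact: dual_norm_ge0 (phiM j).
move=> z z1 r r0.
(* With [A = |psi z|], the final bound is [(1 - q)^2 (1 + A - 2 q)], which is at
   least [1 + A - 2 q (2 + A)]. *)
pose q := Num.min (1 / 2) (r / (2 * (2 + `|psi z|))).
have A0 : 0 < 2 * (2 + `|psi z|) by rewrite mulr_gt0// ltr_wpDr.
have q0 : 0 < q by rewrite lt_min divr_gt0//= divr_gt0.
have q2 : q <= 1 / 2 by rewrite ge_min lexx.
have qr : q * (2 * (2 + `|psi z|)) <= r by rewrite -ler_pdivlMr// ge_min lexx orbT.
have [n zn] : exists n,
    `|psi z - index_sum (fun j => psi (Fsum_inj e X j (z j))) n| <= q.
  have /cvgrPdist_le/(_ q q0)[n _ zn] := scalar_partial_cvg psiM (x := z).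
  by exists n; apply: zn => /=.
have /scalar_ex[g gE] := weighted_sum_scalar e c n.
have gM f : `|g f| <= index_sum c n * `|f| by rewrite gE weighted_sum_bounded.
have g0 : positive_functional e g.
  move=> f f0; rewrite gE /weighted_sum /index_sum sumr_ge0// => i _.
  by rewrite /index_term; case: insub => // j; rewrite mulr_ge0.
have abs0 (x : Fsum e X) : nonneg e (Fsum_abs x) by move=> j; rewrite coord_Fsum_abs.
have gz : `|psi z| - q <= g (Fsum_abs z).
  have : `|index_sum (fun j => psi (Fsum_inj e X j (z j))) n| <= g (Fsum_abs z).
    rewrite gE (le_trans (norm_index_sum _ _))//; apply: le_index_sum => j.
    by rewrite /= -phiE coord_Fsum_abs; exact: le_dual_norm (phiM j).
  move: zn; set S := index_sum _ n => zn.
  have : `|psi z| <= `|psi z - S| + `|S|.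
    by rewrite -[in leLHS](subrK S (psi z)) ler_normD.
  lra.
have gy := dF g _ (Fsum_abs x0) gM g0 (abs0 x0) x01.
have [f [f0 f1 fz]] := tensor_daugavet_nonneg g0 (abs0 x0) gy z1 q0.
have : forall j, exists x : X j, [/\ `|x| <= bcoord e f j,
    forall s, 0 <= s -> (1 - q) * (bcoord e f j + s * `|x0 j|) <= `|x + s *: x0 j| &
    (1 - q) * (c j * bcoord e f j) <= phi j x].
  by move=> j; exact: daugavet_slice_scaled (phiM j) (f0 j) q0.
move=> /(_ _)/cid-/all_sig[u uP].
have [|x xE] := @Fsum_ex _ _ _ e X u f; first by move=> j; case: (uP j).
have q1 : 0 <= 1 - q by lra.
have psix : (1 - q) * g f <= psi x.
  apply: le_trans (partial_le_scalar n psiM _) => [|j]; last first.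
    by rewrite -phiE xE; case: (uP j) => _ _; apply: le_trans; rewrite !mulr_ge0.
  rewrite gE /weighted_sum (raddf_index_sum (h := *%R (1 - q))) ?mulr0//.
    by apply: le_index_sum => j; rewrite -phiE xE; case: (uP j).
  exact: mulrDr.
have gf0 : 0 <= g f by exact: g0.
have psix0 : 0 <= psi x by rewrite (le_trans _ psix)// mulr_ge0.
exists x.
  apply: le_trans f1; apply: Fsum_norm_le => j.
  by rewrite xE ger0_norm//; case: (uP j).
(* [psi x] may exceed [(1 - q) * g f], so the norm estimate is used at
   [s = psi x], and only then compared with [g f]. *)
have xlow : (1 - q) * ((1 - q) * `|f + g f *: Fsum_abs x0|) <= `|x + psi x *: x0|.
  rewrite -[X in X * (X * _) <= _]ger0_norm// -!normrZ.
  apply: Fsum_norm_ge => j; rewrite !coordZ coordD coordZ coord_Fsum_abs.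
  rewrite ger0_norm; last by rewrite !mulr_ge0// addr_ge0 ?(f0 j)// mulr_ge0.
  case: (uP j) => _ /(_ _ psix0) + _; rewrite -xE; apply: le_trans.
  rewrite ler_wpM2l// mulrDr mulrA lerD// ?ler_wpM2r//.
  by rewrite -[leRHS]mul1r ler_wpM2r//; lra.
apply: le_trans xlow.
have B0 : 0 <= 1 + `|psi z| - 2 * q by have := normr_ge0 (psi z); lra.
have fB : 1 + `|psi z| - 2 * q <= `|f + g f *: Fsum_abs x0|.
  by have := ler_norm (g (Fsum_abs z)); lra.
apply: le_trans (ler_wpM2l q1 (ler_wpM2l q1 fB)).
have := mulr_ge0 (ltW q0) (mulr_ge0 (ltW q0) B0).
have := mulr_ge0 (ltW q0) (ltW q0).
lra.
Qed.

Theorem theorem5p1 (R : realType) (F : completeNormedModType R)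
    (N : option nat) (e : unconditional_basis F N)
    (X : basis_index N -> completeNormedModType R)
    (X_neq0 : forall j, exists x : X j, x != 0)
    (X_daugavet : forall j, daugavet (X j)) :
  daugavet (Fsum e X) <-> positive_daugavet e.
Proof.
split; first exact: positive_daugavet_of_Fsum X_neq0.
exact: Fsum_daugavet X_neq0 X_daugavet.
Qed.
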